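(* Let $R$ be a transcendental Dedekind domain, and let $\lambda,\eta$ be non-zero elements algebraic over the fraction field of $R$ such that $\lambda/\eta$ is not a root of unity. Assume that $(\lambda+\eta)^2\in R$ and $\lambda\eta\in R$, and that the principal ideals $\langle(\lambda+\eta)^2\rangle$ and $\langle\lambda\eta\rangle$ of $R$ are coprime ideals which are not both equal to $R$. Define the Lehmer sequence $(U_n)_{n\ge1}$ by $U_n=\frac{\lambda^n-\eta^n}{\lambda-\eta}$ if $n$ is odd and $U_n=\frac{\lambda^n-\eta^n}{\lambda^2-\eta^2}$ if $n$ is even. Then $(U_n)_{n\ge1}$ is a strong divisibility sequence in $R$: for all positive integers $m,n$, a greatest common divisor $\gcd(U_m,U_n)$ in $R$ and $U_{\gcd(m,n)}$ are associated.
   Context: A Dedekind domain $R$ is called transcendental if it is not a field but contains a field. Two elements of $R$ are associated if one equals the other times a unit of $R$. A greatest common divisor of $a,b\in R$ is a common divisor of $a$ and $b$ that is divisible by every common divisor of $a$ and $b$. A sequence $(a_n)_{n\ge1}$ in $R$ is a strong divisibility sequence if for all positive integers $m,n$, $\gcd(a_m,a_n)$ and $a_d$ are associated, where $d=\gcd(m,n)$. *)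

(* Defs.v *)
From mathcomp Require Import all_boot all_order all_algebra.
From mathcomp Require Import boolp.

Set Implicit Arguments.
Unset Strict Implicit.
Unset Printing Implicit Defensive.

Import GRing.Theory.
Local Open Scope ring_scope.

(* [idealr_closed] is the library's notion of a *proper* ideal (1 \notin I).
   Finite generation is thus only required of proper ideals below, which is
   harmless since the unit ideal is generated by 1. *)

Definition finitely_generated (R : comNzRingType) (I : {pred R}) : Prop :=
  exists s : seq R, forall x : R,
    x \in I <-> exists c : 'I_(size s) -> R, x = \sum_(i < size s) c i * s`_i.

Definition noetherian (R : comNzRingType) : Prop :=
  forall I : {pred R}, idealr_closed I -> finitely_generated I.

Definition integrally_closed (R : idomainType) : Prop :=
  forall x : {fraction R},
    integralOver (@tofrac R) x -> exists r : R, x = tofrac r.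

Definition prime_ideal (R : comNzRingType) (I : {pred R}) : Prop :=
  idealr_closed I /\ prime_idealr_closed I.

Definition maximal_ideal (R : comNzRingType) (I : {pred R}) : Prop :=
  idealr_closed I /\
  forall J : {pred R}, idealr_closed J -> {subset I <= J} -> J =i I.

(* Fields are Dedekind domains under this convention; they are excluded in
   [transcendental_dedekind]. *)
Definition dedekind (R : idomainType) : Prop :=
  [/\ noetherian R, integrally_closed R &
      forall I : {pred R}, prime_ideal I ->
        (exists2 x, x \in I & x != 0) -> maximal_ideal I].

Definition contains_field (R : comNzRingType) : Prop :=
  exists K : {pred R}, GRing.subring_closed K /\
    {in K, forall x, x != 0 -> exists2 y, y \in K & x * y = 1}.

Definition transcendental_dedekind (R : idomainType) : Prop :=
  [/\ dedekind R, ~ GRing.field_axiom R & contains_field R].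

Definition divides (R : comNzRingType) (a b : R) : Prop :=
  exists c : R, b = c * a.

Definition associated (R : comUnitRingType) (a b : R) : Prop :=
  exists2 u : R, u \is a GRing.unit & a = u * b.

Definition is_gcd (R : comNzRingType) (g a b : R) : Prop :=
  [/\ divides g a, divides g b &
      forall d : R, divides d a -> divides d b -> divides d g].

(* The existence of a gcd, not automatic in a Dedekind domain, is part of the
   property. The value [a 0] is irrelevant: sequences are indexed by n >= 1. *)
Definition strong_divisibility_sequence (R : comUnitRingType) (a : nat -> R)
    : Prop :=
  forall m n : nat, (0 < m)%N -> (0 < n)%N ->
    exists2 g : R, is_gcd g (a m) (a n) & associated g (a (gcdn m n)).

Definition principal_ideal (R : comNzRingType) (a : R) : {pred R} :=
  [pred x | `[< divides a x >]].

Definition ideal_sum (R : comNzRingType) (I J : {pred R}) : {pred R} :=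
  [pred z | `[< exists x y, [/\ x \in I, y \in J & z = x + y] >]].

Definition coprime_ideals (R : comNzRingType) (I J : {pred R}) : Prop :=
  ideal_sum I J =i predT.

Definition lehmer (L : fieldType) (lambda eta : L) (n : nat) : L :=
  if odd n then (lambda ^+ n - eta ^+ n) / (lambda - eta)
  else (lambda ^+ n - eta ^+ n) / (lambda ^+ 2 - eta ^+ 2).

(* Main.v *)
(** The sequence is given inside [R] by the recurrence
    [U (n+2) = (P or 1) * U (n+1) - Q * U n], and satisfies an addition law
    [U (m+n) = p * U m + r * U n].  Comaximality of [P] and [Q] makes [U n]
    comaximal with [Q], hence with [U (n+1)], and with [P] for odd [n]; so the
    coefficient [p] is comaximal with [U n].  Thus [U (m+n), U n] and
    [U m, U n] generate the same ideal, and the Euclidean algorithm on indices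
    shows that [U m, U n] generate the ideal of [U (gcdn m n)]. *)
Require Import Defs.
From mathcomp Require Import all_boot all_order all_algebra.
From mathcomp Require Import boolp ring.

Set Implicit Arguments.
Unset Strict Implicit.
Unset Printing Implicit Defensive.

Import GRing.Theory.
Local Open Scope ring_scope.

Definition comaximal (R : comNzRingType) (a b : R) : Prop :=
  exists x y : R, x * a + y * b = 1.

(** Equality of the ideals [(g)] and [(a, b)], stronger than [is_gcd]. *)
Definition bezout_gcd (R : comNzRingType) (g a b : R) : Prop :=
  [/\ divides g a, divides g b & exists x y : R, g = x * a + y * b].

(** The Lucas recurrence has coefficients [lambda + eta] and [Q]. Dividing its even terms by
    [lambda + eta] leaves [P] at odd target indices and [1] at even ones. *)
Fixpoint lehmer_rec (R : comNzRingType) (P Q : R) (n : nat) : R :=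
  match n with
  | 0 => 0
  | 1 => 1
  | (k.+1 as m).+1 =>
      (if odd k then P else 1) * lehmer_rec P Q m - Q * lehmer_rec P Q k
  end.

Section Comaximal.
Variable R : comNzRingType.
Implicit Types a b c g r : R.

Lemma comaximal1 a : comaximal 1 a.
Proof. by exists 1, 0; ring. Qed.

Lemma comaximal_sym a b : comaximal a b -> comaximal b a.
Proof. by case=> x [y e]; exists y, x; rewrite addrC. Qed.

Lemma comaximalM a b c : comaximal a c -> comaximal b c -> comaximal (a * b) c.
Proof.
move=> [x [y e]] [z [t e']]; exists (x * z), (x * a * t + y).
by rewrite -[RHS]e -[x * a in RHS]mulr1 -[in RHS]e'; ring.
Qed.

Lemma comaximalDl a c r : comaximal a c -> comaximal (a + r * c) c.
Proof. by move=> [x [y e]]; exists x, (y - x * r); rewrite -e; ring. Qed.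

Lemma bezout_gcd0l a : bezout_gcd a 0 a.
Proof. by split; [exists 0 | exists 1 | exists 0, 1]; ring. Qed.

Lemma bezout_gcd_sym g a b : bezout_gcd g a b -> bezout_gcd g b a.
Proof. by case=> ga gb [x [y e]]; split=> //; exists y, x; rewrite addrC. Qed.

(** If [s * p + t * b = 1], then [a = s * (p * a + r * b) + (t * a - s * r) * b], so both pairs
    generate the same ideal. *)
Lemma bezout_gcd_comb g p r a b :
  comaximal p b -> bezout_gcd g a b -> bezout_gcd g (p * a + r * b) b.
Proof.
move=> [s [t e]] [[u ua] [v vb] [x [y eg]]]; split.
- by exists (p * u + r * v); rewrite ua vb; ring.
- by exists v.
exists (x * s), (y + x * t * a - x * s * r).
by rewrite {1}eg -[x in LHS]mulr1 -e; ring.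
Qed.

Lemma bezout_is_gcd g a b : bezout_gcd g a b -> is_gcd g a b.
Proof.
move=> [ga gb [x [y eg]]]; split=> // d [u ea] [v eb].
by exists (x * u + y * v); rewrite eg ea eb; ring.
Qed.

End Comaximal.

Section LehmerRec.
Variables (R : comNzRingType) (P Q : R).
Local Notation U := (lehmer_rec P Q).

Lemma lehmer_recSS n :
  U n.+2 = (if odd n then P else 1) * U n.+1 - Q * U n.
Proof. by []. Qed.

(** The Lucas addition law, with parity tests accounting for the factors [lambda + eta] removed from
    even terms. *)
Lemma lehmer_rec_add m n :
  U (m.+1 + n) = (if odd m && odd n then P else 1) * U n.+1 * U m.+1
    - Q * (if odd m || odd n then 1 else P) * U m * U n.
Proof.
suff: U (m.+1 + n) = (if odd m && odd n then P else 1) * U n.+1 * U m.+1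
          - Q * (if odd m || odd n then 1 else P) * U m * U n
   /\ U (m.+1 + n.+1) =
        (if odd m && odd n.+1 then P else 1) * U n.+2 * U m.+1
          - Q * (if odd m || odd n.+1 then 1 else P) * U m * U n.+1 by case.
elim: n => [|n [IH1 IH2]].
  rewrite addn0 addn1 !lehmer_recSS /=.
  by case: (odd m) => /=; split; ring.
split=> //; rewrite !addnS !addSn in IH1 IH2 *.
rewrite lehmer_recSS IH1 IH2 !lehmer_recSS /= oddD.
by case: (odd m); case: (odd n) => /=; ring.
Qed.

Hypothesis comaxPQ : comaximal P Q.

Lemma lehmer_rec_comaximal_Q n : comaximal (U n.+1) Q.
Proof.
elim: n => [|n IH]; first exact: comaximal1.
rewrite lehmer_recSS [Q * _]mulrC -mulNr; apply: comaximalDl.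
by apply: comaximalM => //; case: ifP => // _; exact: comaximal1.
Qed.

(** Modulo [U n.+1], the next term is [- Q * U n], a product of two units. *)
Lemma lehmer_rec_comaximalS n : comaximal (U n.+1) (U n).
Proof.
elim: n => [|n IH]; first exact: comaximal1.
rewrite lehmer_recSS addrC; apply: comaximalDl; rewrite -mulNr.
apply: comaximalM; last exact: comaximal_sym.
by case: (lehmer_rec_comaximal_Q n) => x [y e]; exists (- y), x; rewrite -e; ring.
Qed.

(** Modulo [P], each step between odd indices multiplies by [- Q], starting from [U 1 = 1]. *)
Lemma lehmer_rec_comaximal_P n : odd n -> comaximal P (U n).
Proof.
rewrite -{2}[n]odd_double_half => ->; move: n./2 => {}n; apply: comaximal_sym.
elim: n => [|n IH]; first exact: comaximal1.
rewrite add1n in IH *; rewrite doubleS lehmer_recSS /= odd_double /=.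
rewrite [P * _]mulrC addrC; apply: comaximalDl; rewrite -mulNr.
apply: comaximalM => //.
by case: comaxPQ => x [y e]; exists (- y), x; rewrite -e; ring.
Qed.

Lemma lehmer_rec_addE m n :
  exists p r, comaximal p (U n) /\ U (m + n) = p * U m + r * U n.
Proof.
case: m => [|m].
  by exists 1, 1; split; [exact: comaximal1 | rewrite add0n /=; ring].
exists ((if odd m && odd n then P else 1) * U n.+1).
exists (- (Q * (if odd m || odd n then 1 else P) * U m)).
rewrite lehmer_rec_add mulNr; split=> //.
apply: comaximalM; last exact: lehmer_rec_comaximalS.
(* The factor [P] occurs only when [n] is odd, which is where it is comaximal with [U n]. *)
case: ifP => [/andP[_ on]|_]; last exact: comaximal1.
exact: lehmer_rec_comaximal_P.
Qed.

Lemma lehmer_rec_bezout m n : bezout_gcd (U (gcdn m n)) (U m) (U n).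
Proof.
have [k] := ubnP (m + n)%N; elim: k m n => // k IH m n.
wlog le_nm : m n / (n <= m)%N => [hw|].
  have [le|/ltnW le] := leqP n m; first exact: hw.
  by rewrite addnC gcdnC => lt; apply: bezout_gcd_sym; apply: hw.
case: n le_nm => [|n] le_nm lt.
  by rewrite gcdn0; apply: bezout_gcd_sym; exact: bezout_gcd0l.
(* Subtractive Euclid: [m] becomes [m - n.+1], which lowers the sum of the indices. *)
rewrite -(subnK le_nm) gcdnC gcdnDr gcdnC.
have [p [r [cp ->]]] := lehmer_rec_addE (m - n.+1) n.+1.
apply: bezout_gcd_comb => //; apply: IH.
by rewrite subnK // -ltnS; apply: leq_trans lt; rewrite addnS !ltnS leq_addr.
Qed.

End LehmerRec.

Lemma lehmer_rec_strong_divisibility (R : comUnitRingType) (P Q : R) :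
  comaximal P Q -> strong_divisibility_sequence (lehmer_rec P Q).
Proof.
move=> cPQ m n _ _; exists (lehmer_rec P Q (gcdn m n)).
  by apply: bezout_is_gcd; exact: lehmer_rec_bezout.
by exists 1; rewrite ?unitr1 ?mul1r.
Qed.

Lemma rmorph_lehmer_rec (R S : comNzRingType) (f : {rmorphism R -> S})
    (P Q : R) n : f (lehmer_rec P Q n) = lehmer_rec (f P) (f Q) n.
Proof.
suff: f (lehmer_rec P Q n) = lehmer_rec (f P) (f Q) n
  /\ f (lehmer_rec P Q n.+1) = lehmer_rec (f P) (f Q) n.+1 by case.
elim: n => [|n [IH1 IH2]]; first by rewrite rmorph0 rmorph1.
split=> //; rewrite !lehmer_recSS rmorphB !rmorphM IH1 IH2.
by case: (odd n); rewrite ?rmorph1.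
Qed.

(** The closed form with denominators cleared: the multiplier is [a - b] for odd [n] and
    [a ^+ 2 - b ^+ 2] for even [n]. *)
Lemma lehmer_rec_mul (S : comNzRingType) (a b : S) n :
  lehmer_rec ((a + b) ^+ 2) (a * b) n * ((if odd n then 1 else a + b) * (a - b))
  = a ^+ n - b ^+ n.
Proof.
set U := lehmer_rec _ _; pose w k := (if odd k then 1 else a + b) * (a - b).
suff: U n * w n = a ^+ n - b ^+ n /\ U n.+1 * w n.+1 = a ^+ n.+1 - b ^+ n.+1.
  by case.
elim: n => [|n [IH1 IH2]]; first by rewrite /U /w /=; split; ring.
split=> //; rewrite /U lehmer_recSS -/U.
have -> : a ^+ n.+2 - b ^+ n.+2 =
    (a + b) * (a ^+ n.+1 - b ^+ n.+1) - a * b * (a ^+ n - b ^+ n).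
  by rewrite !exprS; ring.
by rewrite -IH1 -IH2 /w /=; case: (odd n) => /=; ring.
Qed.

Lemma lehmer_recE (L : fieldType) (a b : L) n : a ^+ 2 != b ^+ 2 ->
  lehmer_rec ((a + b) ^+ 2) (a * b) n = lehmer a b n.
Proof.
rewrite -subr_eq0 => ab0; move: (ab0).
rewrite subr_sqr mulf_eq0 negb_or /lehmer => /andP[d0 _].
rewrite -(lehmer_rec_mul a b n); case: (odd n); first by rewrite mul1r mulfK.
by rewrite [(a + b) * _]mulrC -subr_sqr mulfK.
Qed.

Lemma coprime_principal_comaximal (R : comNzRingType) (a b : R) :
  coprime_ideals (principal_ideal a) (principal_ideal b) -> comaximal a b.
Proof.
move/(_ 1); rewrite [in RHS]inE => /asboolP[x [y []]].
by rewrite !inE => /asboolP[u ->] /asboolP[v ->] e; exists u, v.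
Qed.

Theorem theorem1p1 (R : idomainType) (L : fieldType)
    (iota : {rmorphism {fraction R} -> L}) (lambda eta : L) (P Q : R) :
  transcendental_dedekind R ->
  lambda != 0 -> eta != 0 ->
  algebraicOver iota lambda -> algebraicOver iota eta ->
  (forall n : nat, (0 < n)%N -> ~~ n.-unity_root (lambda / eta)) ->
  iota (tofrac P) = (lambda + eta) ^+ 2 ->
  iota (tofrac Q) = lambda * eta ->
  coprime_ideals (principal_ideal P) (principal_ideal Q) ->
  ~ (principal_ideal P =i predT /\ principal_ideal Q =i predT) ->
  exists2 U : nat -> R,
    (forall n : nat, (0 < n)%N -> iota (tofrac (U n)) = lehmer lambda eta n) &
    strong_divisibility_sequence U.
Proof.
move=> _ _ eta0 _ _ not_root eP eQ cPQ _; exists (lehmer_rec P Q); last first.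
  by apply: lehmer_rec_strong_divisibility; exact: coprime_principal_comaximal.
move=> n _; rewrite !rmorph_lehmer_rec eP eQ; apply: lehmer_recE.
(* Equal squares would make [lambda / eta] a square root of unity. *)
apply: contra (not_root 2 isT) => /eqP e.
by rewrite unity_rootE expr_div_n e divff // expf_neq0.
Qed.
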